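(* For every $\alpha\in(0,1)$ and every $u\in H^\alpha(S_\varepsilon)$ one has $$\|\mathcal T^b_\varepsilon(u)\|'_{L^2(\Omega;H^\alpha(S))}=\varepsilon^{1/2+\alpha}\,\|u\|'_{H^\alpha(S_\varepsilon)}.$$
   Context: $\Omega\subset\mathbb R^3$ is a bounded domain with Lipschitz boundary, $\mathbf Y=(0,1)^3$. $\mathcal S$ is a domain strictly included in $\mathbf Y$ with $C^{1,1}$ boundary; $S$ is the closure of an open connected subset of $\partial\mathcal S$. For a.e. $z\in\mathbb R^3$, $z=[z]+\{z\}$ with $[z]\in\mathbb Z^3$, $\{z\}\in\mathbf Y$. For $\varepsilon>0$: $\Xi_\varepsilon=\{\xi\in\mathbb Z^3:\varepsilon\xi+\varepsilon\mathbf Y\subset\Omega\}$, $\widehat\Omega_\varepsilon=\mathrm{interior}\bigcup_{\xi\in\Xi_\varepsilon}(\varepsilon\xi+\varepsilon\overline{\mathbf Y})$, $\Lambda_\varepsilon=\Omega\setminus\overline{\widehat\Omega_\varepsilon}$, $S_\varepsilon=\{x\in\widehat\Omega_\varepsilon:\{x/\varepsilon\}\in S\}$. Semi-norms: $\|v\|'^2_{H^\alpha(S)}=\int_S\int_S\frac{|v(x)-v(y)|^2}{|x-y|^{2+2\alpha}}d\sigma_xd\sigma_y$; $H^\alpha(S_\varepsilon)$ is the set of $v\in L^2(S_\varepsilon)$ for which $\|v\|'^2_{H^\alpha(S_\varepsilon)}=\sum_{\xi\in\Xi_\varepsilon}\int_{\varepsilon\xi+\varepsilon S}\int_{\varepsilon\xi+\varepsilon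 S}\frac{|v(x)-v(y)|^2}{|x-y|^{2+2\alpha}}d\sigma_xd\sigma_y<\infty$; $\|\Phi\|'^2_{L^2(\Omega;H^\alpha(S))}=\int_\Omega\|\Phi(x,\cdot)\|'^2_{H^\alpha(S)}dx$. Boundary unfolding operator: $\mathcal T^b_\varepsilon(\phi)(x,y)=\phi(\varepsilon[x/\varepsilon]+\varepsilon y)$ for a.e. $(x,y)\in\widehat\Omega_\varepsilon\times S$, and $\mathcal T^b_\varepsilon(\phi)(x,y)=0$ for a.e. $(x,y)\in\Lambda_\varepsilon\times S$. *)

(* Defs.v *)
From HB Require Import structures.
From mathcomp Require Import all_boot all_order all_algebra.
From mathcomp Require Import all_classical all_reals all_analysis.

Set Implicit Arguments.
Unset Strict Implicit.
Unset Printing Implicit Defensive.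
Import Order.TTheory GRing.Theory Num.Theory.
Import numFieldNormedType.Exports.
Local Open Scope classical_set_scope.
Local Open Scope ring_scope.

(* R^3 and Z^3 are triples. The topology and the Borel sigma-algebra of the
   library on R * R * R are the usual ones, but its norm is the sup norm, hence
   the Euclidean norm enorm below. *)
Notation R3 R := (R * R * R)%type.
Notation Z3 := (int * int * int)%type.

Section euclidean_space.
Context {R : realType}.
Implicit Types x y z : R3 R.

Definition dot x y : R := x.1.1 * y.1.1 + x.1.2 * y.1.2 + x.2 * y.2.

Definition enorm x : R := Num.sqrt (dot x x).

Definition z3r (xi : Z3) : R3 R := (xi.1.1%:~R, xi.1.2%:~R, xi.2%:~R).

(* [z] and {z}; componentwise floor, so that {z} lies in [0, 1[^3 for every z
   and in Y for almost every z *)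
Definition int_part z : Z3 :=
  (Num.floor z.1.1, Num.floor z.1.2, Num.floor z.2).

Definition frac_part z : R3 R := z - z3r (int_part z).

Definition unit_cell : set (R3 R) :=
  [set y | [/\ 0 < y.1.1 < 1, 0 < y.1.2 < 1 & 0 < y.2 < 1]].

Definition lebesgue3 :=
  (@lebesgue_measure R \x @lebesgue_measure R \x @lebesgue_measure R)%E.
HB.instance Definition _ := Measure.on lebesgue3.

End euclidean_space.

Section domains.
Context {R : realType}.
Implicit Types (A O D : set (R3 R)) (e : R3 R).

Definition is_domain D := [/\ open D, connected D & D !=set0].

Definition frontier A := closure A `\` interior A.

Definition orthonormal e1 e2 e3 :=
  [/\ dot e1 e1 = 1, dot e2 e2 = 1 & dot e3 e3 = 1] /\
  [/\ dot e1 e2 = 0, dot e1 e3 = 0 & dot e2 e3 = 0].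

(* Near each boundary point, and in a suitable orthonormal frame, D is the
   region above the graph of a function of two variables in the class C. *)
Definition graph_boundary (C : set (R * R -> R)) D :=
  forall p, frontier D p ->
  exists2 r : R, 0 < r &
  exists e1 e2 e3, orthonormal e1 e2 e3 /\
  exists2 g, C g &
    forall x, enorm (x - p) < r ->
      (D x <-> g (dot x e1, dot x e2) < dot x e3).

Definition lipschitz_boundary D :=
  graph_boundary [set g | lipschitz g] D.

Definition C11 : set (R * R -> R) :=
  [set g | (forall q, differentiable g q) /\
           (forall v, lipschitz (fun q => 'D_v g q))].

Definition C11_boundary D := graph_boundary C11 D.

End domains.

(* Surface measure: the two-dimensional Hausdorff measure of R^3, normalized by
   pi / 4 so as to agree with area on surfaces *)
Section surface_measure.
Context {R : realType}.
Implicit Types A B : set (R3 R).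
Local Open Scope ereal_scope.

(* the maximum with 0 takes care of the empty set *)
Definition diam A : \bar R :=
  maxe 0 (ereal_sup [set (enorm (p.1 - p.2))%:E | p in A `*` A]).

Definition hausdorff_pre (d : R) A : \bar R :=
  ereal_inf [set \sum_(k <oo) (pi / 4)%:E * diam (C k) ^+ 2 |
    C in [set C : (set (R3 R))^nat |
            A `<=` \bigcup_k C k /\ forall k, diam (C k) <= d%:E]].

Definition hausdorff2 A : \bar R :=
  ereal_sup [set hausdorff_pre d A | d in [set d : R | (0 < d)%R]].

Let discrete := g_sigma_algebraType [set: set (R3 R)].

Let measurable_discrete (A : set discrete) : measurable A.
Proof. exact: sub_sigma_algebra. Qed.

Let weight (d : R) (A : set discrete) : \bar R :=
  if diam A <= d%:E then (pi / 4)%:E * diam A ^+ 2 else +oo.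

Let diam_ge0 A : 0 <= diam A.
Proof. by rewrite /diam le_max lexx. Qed.

Let diam0 : diam set0 = 0.
Proof.
rewrite /diam set0X image_set0 ereal_sup0; exact/max_idPl/leNye.
Qed.

Let area_ge0 A : 0 <= (pi / 4)%:E * diam A ^+ 2.
Proof.
apply: mule_ge0; first by rewrite lee_fin divr_ge0 ?pi_ge0.
exact: expe_ge0.
Qed.

Let weight_ge0 d A : 0 <= weight d A.
Proof. by rewrite /weight; case: ifP => _; [exact: area_ge0|exact: leey]. Qed.

Let weight0 d : (0 < d)%R -> weight d set0 = 0.
Proof. by move=> d0; rewrite /weight diam0 lee_fin ltW// expe2 mul0e mule0. Qed.

Let hausdorff_preE d A : hausdorff_pre d A = mu_ext (weight d) A.
Proof.
apply/eqP; rewrite eq_le; apply/andP; split; apply: le_ereal_inf_tmp.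
  move=> _ [C [_ AC] <-].
  have [dC|/existsNP[k dC]] := pselect (forall k, diam (C k) <= d%:E).
    apply: ereal_inf_lbound; exists C => //.
    by apply: eq_eseriesr => k _; rewrite /weight dC.
  rewrite (eseries_pinfty (k := k)) ?leey//.
  - by move=> n _; rewrite -ltNye (lt_le_trans _ (weight_ge0 _ _)).
  - by rewrite /weight; case: ifPn => // /dC.
move=> _ [C [AC dC] <-]; apply: ereal_inf_lbound; exists C => //.
by apply: eq_eseriesr => k _; rewrite /weight dC.
Qed.

Let hausdorff_pre_le d A : (0 < d)%R -> hausdorff_pre d A <= hausdorff2 A.
Proof. by move=> d0; apply: ereal_sup_ubound; exists d. Qed.

Lemma hausdorff2_0 : hausdorff2 set0 = 0.
Proof.
rewrite /hausdorff2 (_ : image _ _ = [set 0]) ?ereal_sup1//.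
apply/seteqP; split=> [_ [d /= d0 <-]|_ ->] /=.
  by rewrite hausdorff_preE mu_ext0//; exact: weight0.
by exists 1%R => //; rewrite hausdorff_preE mu_ext0//; exact: weight0.
Qed.

Lemma hausdorff2_ge0 A : 0 <= hausdorff2 A.
Proof.
apply: le_trans (hausdorff_pre_le A ltr01).
by rewrite hausdorff_preE; exact: mu_ext_ge0.
Qed.

Lemma le_hausdorff2 : {homo hausdorff2 : A B / A `<=` B >-> A <= B}.
Proof.
move=> A B AB; apply: ge_ereal_sup => _ [d /= d0 <-].
apply: le_trans (hausdorff_pre_le B d0).
by rewrite !hausdorff_preE; exact: le_mu_ext.
Qed.

Lemma hausdorff2_sigma_subadditive : sigma_subadditive hausdorff2.
Proof.
move=> F; apply: ge_ereal_sup => _ [d /= d0 <-].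
rewrite hausdorff_preE; apply: le_trans.
  by apply: mu_ext_sigma_subadditive => //; exact: weight0.
apply: lee_nneseries => [i|i] *; last by rewrite -hausdorff_preE hausdorff_pre_le.
  exact: (mu_ext_ge0 (mu := weight d) (weight_ge0 d)).
Qed.

HB.instance Definition _ := isOuterMeasure.Build R (R3 R) hausdorff2
  hausdorff2_0 hausdorff2_ge0 le_hausdorff2 hausdorff2_sigma_subadditive.

Definition hausdorff2_outer : {outer_measure set (R3 R) -> \bar R} :=
  hausdorff2.

End surface_measure.

(* R^3 with the sigma-algebra of hausdorff2-measurable sets *)
Notation surfaceType R := (caratheodory_type (@hausdorff2_outer R)).

Definition surface_measure {R : realType} : set (surfaceType R) -> \bar R :=
  hausdorff2_outer.
HB.instance Definition _ (R : realType) := Measure.on (@surface_measure R).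

Section unfolding.
Context {R : realType}.
Implicit Types (eps alpha : R) (Omega S A : set (R3 R)) (v : R3 R -> R).

(* y |-> eps xi + eps y *)
Definition cell_map eps (xi : Z3) (y : R3 R) : R3 R :=
  eps *: z3r xi + eps *: y.

Definition Xi eps Omega : set Z3 :=
  [set xi | cell_map eps xi @` unit_cell `<=` Omega].

Definition Omega_hat eps Omega : set (R3 R) :=
  interior (\bigcup_(xi in Xi eps Omega) cell_map eps xi @` closure unit_cell).

Definition S_eps eps Omega S : set (R3 R) :=
  [set x | Omega_hat eps Omega x /\ S (frac_part (eps^-1 *: x))].

Local Open Scope ereal_scope.

(* The squared Gagliardo semi-norm of v on A; the integrand is 0 on the
   diagonal, by the convention a / 0 = 0. *)
Definition gagliardo2 alpha A v : \bar R :=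
  \int[surface_measure]_(y in A) \int[surface_measure]_(x in A)
    (`|v x - v y| ^+ 2 / enorm (x - y) `^ (2 + 2 * alpha))%R%:E.

Definition seminorm_S_eps2 alpha eps Omega S v : \bar R :=
  \esum_(xi in Xi eps Omega) gagliardo2 alpha (cell_map eps xi @` S) v.

Definition seminorm_S_eps alpha eps Omega S v : \bar R :=
  sqrte (seminorm_S_eps2 alpha eps Omega S v).

Definition L2_S_eps eps Omega S : set (R3 R -> R) :=
  [set v | @measurable_fun _ _ (surfaceType R) R (S_eps eps Omega S) v /\
           \int[surface_measure]_(x in S_eps eps Omega S)
             (`|v x| ^+ 2)%:E < +oo].

Definition H_S_eps alpha eps Omega S : set (R3 R -> R) :=
  [set v | L2_S_eps eps Omega S v /\
           seminorm_S_eps2 alpha eps Omega S v < +oo].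

Definition seminorm_L2H alpha Omega S (Phi : R3 R -> R3 R -> R) : \bar R :=
  sqrte (\int[lebesgue3]_(x in Omega) gagliardo2 alpha S (Phi x)).

(* The boundary unfolding operator. The value 0 is taken on all of the
   complement of Omega_hat; within Omega, this complement is Lambda_eps up to
   the Lebesgue-negligible frontier of Omega_hat. *)
Definition unfolding eps Omega (phi : R3 R -> R) (x y : R3 R) : R :=
  if x \in Omega_hat eps Omega
  then phi (cell_map eps (int_part (eps^-1 *: x)) y) else 0%R.

End unfolding.

(* Main.v *)
From HB Require Import structures.
Require Import Defs.
From mathcomp Require Import all_boot all_order all_algebra.
From mathcomp Require Import all_classical all_reals all_analysis.
From mathcomp Require Import measurable_realfun ring.

Set Implicit Arguments.
Unset Strict Implicit.
Unset Printing Implicit Defensive.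
Import Order.TTheory GRing.Theory Num.Theory.
Import numFieldNormedType.Exports.
Local Open Scope classical_set_scope.
Local Open Scope ring_scope.

(** Write phi_xi for the map y |-> eps xi + eps y (cell_map). It is a similarity
of ratio eps, so it multiplies the two-dimensional Hausdorff measure by eps^2.
In the double integral over phi_xi(S) each of the two integrations therefore
contributes eps^2 and the kernel |x - y|^(-2 - 2 alpha) contributes
eps^(-2 - 2 alpha): the squared semi-norm of u on phi_xi(S) is
eps^(2 - 2 alpha) times that of u o phi_xi on S (gagliardo2_similarity).

The unfolded function is x |-> u o phi_xi on the part of Omega_hat that lies in
the half-open cell of index xi, and 0 outside Omega_hat. Its squared semi-norm
is therefore a function of x that only takes countably many values, and
integrating it over Omega amounts to summing value times volume over the cells.
The volume is eps^3 when xi is in Xi and 0 otherwise (lebesgue3_hat_cell): the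
open cell of an index in Xi lies in Omega and in Omega_hat, an open cell that
meets Omega_hat has its index in Xi, and a half-open cell differs from the open
one by a null set. The factor in front of the sum is then
eps^3 eps^(2 alpha - 2) = eps^(1 + 2 alpha), whose square root is
eps^(1/2 + alpha).

The measurability of the inner integral as a function of the outer variable
would be a delicate point; it is avoided by changing variables in integrals of
arbitrary nonnegative functions (ge0_integral_image). The integral of such a
function is the supremum of the integrals of the simple functions below it, and
a bimeasurable bijection that multiplies the measure by a constant puts the
simple functions of both sides in correspondence. *)

(** * Change of variables for arbitrary nonnegative functions *)

Section comp_nnsfun.
Context d1 d2 (X : measurableType d1) (Y : measurableType d2) (R : realType).
Variables (psi : Y -> X) (mpsi : measurable_fun setT psi).
Import HBNNSimple.
Variable h : {nnsfun X >-> R}.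

Let hpsi : Y -> R := h \o psi.

Let hpsi_mfun : @isMeasurableFun _ _ Y R hpsi.
Proof. by split; exact: measurableT_comp. Qed.

Let hpsi_fimfun : @FiniteImage Y R hpsi.
Proof.
split; apply: (@sub_finite_set _ _ (range h)); last exact: fimfunP.
by move=> _ [y _ <-]; exists (psi y).
Qed.

Let hpsi_nnfun : @isNonNegFun Y R hpsi.
Proof. by split=> y; exact: fun_ge0. Qed.

#[local] HB.instance Definition _ := hpsi_mfun.
#[local] HB.instance Definition _ := hpsi_fimfun.
#[local] HB.instance Definition _ := hpsi_nnfun.

Definition comp_nnsfun : {nnsfun Y >-> R} := hpsi.

End comp_nnsfun.

Section change_of_variables.
Context d1 d2 (X : measurableType d1) (Y : measurableType d2) (R : realType).
Variables (mu : {measure set X -> \bar R}) (nu : {measure set Y -> \bar R}).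
Local Open Scope ereal_scope.
Import HBNNSimple.

(** If h is simple and h <= g, then c h o psi is simple and lies below f, and its
integral is k c times that of h; the claim follows by taking suprema. *)
Lemma le_ge0_integral_comp (psi : Y -> X) (k c : R) (g : X -> \bar R)
    (f : Y -> \bar R) :
    measurable_fun setT psi -> (0 < k)%R -> (0 < c)%R ->
    (forall A, measurable A -> nu (psi @^-1` A) = k%:E * mu A) ->
    (forall x, 0 <= g x) -> (forall y, c%:E * g (psi y) <= f y) ->
  (k * c)%:E * \int[mu]_x g x <= \int[nu]_y f y.
Proof.
move=> mpsi k0 c0 nuE g0 gf.
have f0 y : 0 <= f y by rewrite (le_trans _ (gf y))// mule_ge0// lee_fin ltW.
rewrite !ge0_integralTE// -ereal_sup_pZl ?mulr_gt0//.
apply: ge_ereal_sup => _ [_ [h /= hg <-] <-].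
apply: ereal_sup_ubound => /=.
exists (scale_nnsfun (comp_nnsfun mpsi h) (ltW c0)) => /=.
  move=> y; rewrite EFinM (le_trans _ (gf y))// lee_pmul2l// ?lte_fin//.
transitivity (sintegral nu (cst c \* comp_nnsfun mpsi h)%R).
  by congr (sintegral nu _).
rewrite sintegralrM [in RHS]mulrC EFinM -muleA; congr (_ * _).
rewrite !sintegralET ge0_mule_fsumr; last first.
  by move=> x; exact: nnsfun_mulemu_ge0.
by apply: eq_fsbigr => x _; rewrite comp_preimage nuE// muleCA.
Qed.

End change_of_variables.

Section integral_image.
Context d1 d2 (X : measurableType d1) (Y : measurableType d2) (R : realType).
Variables (mu : {measure set X -> \bar R}) (nu : {measure set Y -> \bar R}).
Local Open Scope ereal_scope.

(** Both inequalities are instances of le_ge0_integral_comp, the second one for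
the inverse bijection and the inverse constants. The constant c is kept separate
from g so that a homogeneous kernel can be rescaled in the same step. *)
Lemma ge0_integral_image (phi : X -> Y) (psi : Y -> X) (k c : R)
    (D : set X) (g : X -> \bar R) (f : Y -> \bar R) :
    cancel phi psi -> cancel psi phi ->
    measurable_fun setT phi -> measurable_fun setT psi ->
    (0 < k)%R -> (0 < c)%R ->
    (forall A, measurable A -> nu (psi @^-1` A) = k%:E * mu A) ->
    (forall x, 0 <= g x) -> (forall x, f (phi x) = c%:E * g x) ->
  \int[nu]_(y in phi @` D) f y = (k * c)%:E * \int[mu]_(x in D) g x.
Proof.
move=> phiK psiK mphi mpsi k0 c0 nuE g0 fg.
have f0 y : 0 <= f y by rewrite -(psiK y) fg mule_ge0// lee_fin ltW.
have memE x : (phi x \in phi @` D) = (x \in D).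
  apply/idP/idP; rewrite !inE; last by exists x.
  by move=> [x' Dx' /(can_inj phiK) <-].
have muE B : measurable B -> mu (phi @^-1` B) = k^-1%:E * nu B.
  move=> mB; have mphiB : measurable (phi @^-1` B).
    by rewrite -[X in measurable X]setTI; exact: mphi.
  have psiphiB : psi @^-1` (phi @^-1` B) = B.
    by apply/seteqP; split=> y /=; rewrite psiK.
  by rewrite -[in RHS]psiphiB nuE// muleA -EFinM mulVf ?mul1e// gt_eqF.
rewrite [LHS]integral_mkcond [in RHS]integral_mkcond.
apply/eqP; rewrite eq_le; apply/andP; split; last first.
  apply: (le_ge0_integral_comp mpsi) => // [x|y]; first exact: erestrict_ge0.
  rewrite /patch -memE psiK; case: ifPn => _; last by rewrite mule0.
  by rewrite -fg psiK.
have : (k^-1 * c^-1)%:E * \int[nu]_y (f \_ (phi @` D)) y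
    <= \int[mu]_x (g \_ D) x.
  apply: (le_ge0_integral_comp mphi) => //; rewrite ?invr_gt0//.
    by move=> y; exact: erestrict_ge0.
  move=> x.
  rewrite /patch memE; case: ifPn => _; last by rewrite mule0.
  by rewrite fg muleA -EFinM mulVf ?gt_eqF// mul1e.
have kc0 : (0 < k * c)%R by rewrite mulr_gt0.
rewrite -(@lee_pmul2l _ (k * c)%:E) ?lte_fin// -invfM.
by rewrite muleA -EFinM divff ?mul1e// gt_eqF.
Qed.

End integral_image.

(** * Hausdorff measure and similarities *)

Section hausdorff.
Context {R : realType}.
Implicit Types A B : set (R3 R).
Local Open Scope ereal_scope.

Lemma diam_ge0 A : 0 <= diam A.
Proof. by rewrite /diam le_max lexx. Qed.

Lemma diam_lipschitz_image (phi : R3 R -> R3 R) (k : R) A : (0 < k)%R ->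
  (forall x y, enorm (phi x - phi y) <= k * enorm (x - y))%R ->
  diam (phi @` A) <= k%:E * diam A.
Proof.
move=> k0 phik; rewrite /diam ge_max mule_ge0 ?le_max ?lexx ?lee_fin ?(ltW k0)//=.
apply: ge_ereal_sup => _ [[_ _] /= [[x Ax <-] [y Ay <-]] <-].
apply: (@le_trans _ _ (k * enorm (x - y))%:E); first by rewrite lee_fin.
rewrite EFinM lee_pmul2l ?lte_fin// le_max; apply/orP; right.
by apply: ereal_sup_ubound; exists (x, y).
Qed.

(** The image of a covering by sets of diameter at most d is a covering by sets of
diameter at most k d. *)
Lemma hausdorff_pre_lipschitz_image (phi : R3 R -> R3 R) (k d : R) A :
  (0 < k)%R -> (forall x y, enorm (phi x - phi y) <= k * enorm (x - y))%R ->
  hausdorff_pre (k * d) (phi @` A) <= (k ^+ 2)%:E * hausdorff_pre d A.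
Proof.
move=> k0 phik; rewrite /hausdorff_pre -ereal_inf_pZl ?exprn_gt0//.
apply: le_ereal_inf_tmp => _ [_ [C [/= AC dC] <-] <-].
have pi4 : 0 <= (pi / 4 : R)%:E by rewrite lee_fin divr_ge0 ?pi_ge0.
apply: (@le_trans _ _ (\sum_(i <oo) (pi / 4)%:E * diam (phi @` C i) ^+ 2)).
  apply: ereal_inf_lbound; exists (fun i => phi @` C i) => //=; split.
    by rewrite -image_bigcup; exact: image_subset.
  move=> i; apply: (le_trans (diam_lipschitz_image _ k0 phik)).
  by rewrite EFinM lee_pmul2l ?lte_fin.
rewrite -nneseriesZl; last first.
  by move=> i _; rewrite mule_ge0// sqre_ge0.
apply: lee_nneseries => [i _ _|i _].
  by apply: mule_ge0 => //; exact: sqre_ge0.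
rewrite [leRHS]muleCA; apply: lee_wpmul2l => //.
rewrite EFin_expe !expe2 muleACA.
by apply: lee_pmul; rewrite ?diam_ge0//; exact: diam_lipschitz_image.
Qed.

Lemma hausdorff2_lipschitz_image (phi : R3 R -> R3 R) (k : R) A :
  (0 < k)%R -> (forall x y, enorm (phi x - phi y) <= k * enorm (x - y))%R ->
  hausdorff2 (phi @` A) <= (k ^+ 2)%:E * hausdorff2 A.
Proof.
move=> k0 phik; apply: ge_ereal_sup => _ [d /= d0 <-].
have -> : d = (k * (d / k))%R by rewrite mulrCA divff ?mulr1// gt_eqF.
apply: le_trans (hausdorff_pre_lipschitz_image _ _ k0 phik) _.
rewrite lee_pmul2l ?lte_fin ?exprn_gt0//.
by apply: ereal_sup_ubound; exists (d / k)%R => //=; rewrite divr_gt0.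
Qed.

End hausdorff.

Section similarity.
Context {R : realType}.
Variables (phi psi : R3 R -> R3 R) (k : R).
Hypotheses (phiK : cancel phi psi) (psiK : cancel psi phi) (k0 : 0 < k).
Hypothesis phik : forall x y, enorm (phi x - phi y) = k * enorm (x - y).
Implicit Types A : set (R3 R).

Lemma similarity_inverse x y :
  enorm (psi x - psi y) = k^-1 * enorm (x - y).
Proof. by rewrite -{2}(psiK x) -{2}(psiK y) phik mulKf ?gt_eqF. Qed.

Lemma image_similarity A : phi @` A = psi @^-1` A.
Proof.
apply/seteqP; split=> [_ [x Ax <-]|y] /=; first by rewrite phiK.
by move=> Apy; exists (psi y).
Qed.

Lemma image_similarityK A : psi @` (phi @` A) = A.
Proof.
rewrite image_comp (_ : psi \o phi = id) ?image_id//.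
by apply/funext => x /=; rewrite phiK.
Qed.

Local Open Scope ereal_scope.

(** The Lipschitz bound is applied to phi and, for the converse inequality, to its
inverse. *)
Lemma hausdorff2_similarity A :
  hausdorff2 (phi @` A) = (k ^+ 2)%:E * hausdorff2 A.
Proof.
have k2 : (0 < k ^+ 2)%R by rewrite exprn_gt0.
have kV0 : (0 < k^-1)%R by rewrite invr_gt0.
apply/eqP; rewrite eq_le; apply/andP; split.
  by apply: hausdorff2_lipschitz_image => // x y; rewrite phik.
have : hausdorff2 (psi @` (phi @` A)) <= (k^-1 ^+ 2)%:E * hausdorff2 (phi @` A).
  by apply: hausdorff2_lipschitz_image => // x y; rewrite similarity_inverse.
rewrite image_similarityK -(@lee_pmul2l _ (k ^+ 2)%:E) ?lte_fin//.
by rewrite muleA -EFinM -exprMn divff ?gt_eqF// expr1n mul1e.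
Qed.

(** The splitting condition of Caratheodory is tested on all sets, and phi
permutes the sets while multiplying the outer measure by a nonzero
constant. *)
Lemma measurable_similarity :
  @measurable_fun _ _ (surfaceType R) (surfaceType R) setT psi.
Proof.
move=> _ A mA; rewrite setTI -image_similarity.
have {}mA : caratheodory_measurable hausdorff2 A := mA.
change (caratheodory_measurable hausdorff2 (phi @` A)) => X.
have imV (B : set (R3 R)) : phi @` (phi @^-1` B) = B.
  by apply/seteqP; split=> [_ [x Bx <-]//|x Bx]; exists (psi x); rewrite /= psiK.
have HV (B : set (R3 R)) : hausdorff2 B = (k ^+ 2)%:E * hausdorff2 (phi @^-1` B).
  by rewrite -hausdorff2_similarity imV.
have preimA : phi @^-1` (phi @` A) = A.
  by apply/seteqP; split=> [x [y Ay /(can_inj phiK) <-]//|x Ax]; exists x.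
rewrite [LHS]HV [X in _ = X + _]HV [X in _ = _ + X]HV.
have preimC : phi @^-1` (~` (phi @` A)) = ~` A by rewrite -[in RHS]preimA.
rewrite !preimage_setI preimA preimC.
rewrite -ge0_muleDr ?hausdorff2_ge0//; congr (_ * _).
exact: mA.
Qed.

End similarity.

(** * Scaling of the Gagliardo semi-norm *)

Section gagliardo.
Context {R : realType}.
Variables (phi psi : R3 R -> R3 R) (k : R).
Hypotheses (phiK : cancel phi psi) (psiK : cancel psi phi) (k0 : 0 < k).
Hypothesis phik : forall x y, enorm (phi x - phi y) = k * enorm (x - y).
Local Open Scope ereal_scope.

Lemma integral_similarity (c : R) (D : set (surfaceType R))
    (g f : surfaceType R -> \bar R) : (0 < c)%R ->
    (forall x, 0 <= g x) -> (forall x, f (phi x) = c%:E * g x) ->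
  \int[surface_measure]_(y in phi @` D) f y =
  (k ^+ 2 * c)%:E * \int[surface_measure]_(x in D) g x.
Proof.
move=> c0 g0 fg.
have kV0 : (0 < k^-1)%R by rewrite invr_gt0.
have mphi : @measurable_fun _ _ (surfaceType R) (surfaceType R) setT phi.
  apply: (@measurable_similarity _ psi phi k^-1) => //.
  exact: (similarity_inverse psiK k0 phik).
have mpsi : @measurable_fun _ _ (surfaceType R) (surfaceType R) setT psi.
  exact: (@measurable_similarity _ phi psi k).
have k2 : (0 < k ^+ 2)%R by rewrite exprn_gt0.
have muE (A : set (surfaceType R)) : measurable A ->
    surface_measure (psi @^-1` A) = (k ^+ 2)%:E * surface_measure A.
  move=> _; rewrite -(image_similarity phiK psiK).
  exact: (@hausdorff2_similarity _ phi psi).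
exact: (@ge0_integral_image _ _ (surfaceType R) (surfaceType R) R
  surface_measure surface_measure phi psi (k ^+ 2) c D g f).
Qed.

(** Each of the two integrations contributes k^2 and the kernel k^(-2 - 2 alpha). *)
Lemma gagliardo2_similarity (alpha : R) (S : set (R3 R)) (v : R3 R -> R) :
  gagliardo2 alpha (phi @` S) v =
  (k `^ (2 - 2 * alpha))%:E * gagliardo2 alpha S (v \o phi).
Proof.
have c0 : (0 < (k `^ (2 + 2 * alpha))^-1)%R by rewrite invr_gt0 powR_gt0.
rewrite /gagliardo2.
rewrite (@integral_similarity (k ^+ 2 * (k `^ (2 + 2 * alpha))^-1)
  _ (fun y' => \int[surface_measure]_(x in S)
    (`|v (phi x) - v (phi y')| ^+ 2 / enorm (x - y') `^ (2 + 2 * alpha))%R%:E)).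
- congr (_%:E * _).
  rewrite mulrA -exprD -powRN -!powR_mulrn ?(ltW k0)//= -powRD; last first.
    by rewrite (gt_eqF k0) implybT.
  by congr (_ `^ _)%R; ring.
- by rewrite mulr_gt0// exprn_gt0.
- move=> y; apply: integral_ge0 => x _; rewrite lee_fin mulr_ge0//.
  by rewrite invr_ge0 powR_ge0.
- move=> y; apply: integral_similarity => // x.
    by rewrite lee_fin mulr_ge0// invr_ge0 powR_ge0.
  rewrite phik powRM ?(ltW k0) ?sqrtr_ge0//.
  by rewrite -EFinM invfM mulrCA.
Qed.

End gagliardo.

(** * Borel measurability of open sets *)

(** R^3 with the sigma-algebra on which lebesgue3 is defined. *)
Notation borelR3 R :=
  (measurableTypeR R * measurableTypeR R * measurableTypeR R)%type.

Section open_measurable3.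
Context {R : realType}.

Let rball (q : rat * rat) : set R := ball (ratr q.1 : R) (ratr q.2).

Let rball_nbhs (A : set R) x : nbhs x A -> exists q, rball q x /\ rball q `<=` A.
Proof.
move=> xA.
have [c [r [xB BA]]] := open_subball_rat (@open_interior _ A) (mem_set xA).
exists (c, r); split; first exact: set_mem xB.
by move=> y /BA /interior_subset.
Qed.

(** An open set is the union of the boxes it contains whose sides are balls with
rational centre and radius, and there are countably many of those. *)
Lemma open_measurable3 (U : set (R3 R)) :
  open U -> measurable (U : set (borelR3 R)).
Proof.
move=> oU.
pose box (q : (rat * rat) * (rat * rat) * (rat * rat)) : set (R3 R) :=
  rball q.1.1 `*` rball q.1.2 `*` rball q.2.
have -> : U = \bigcup_q (if `[< box q `<=` U >] then box q else set0).
  apply/seteqP; split=> [[[x y] z] Uxyz|p [q _]]; last first.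
    by case: asboolP => // + bp; exact.
  have : nbhs (x, y, z) U by apply: open_nbhs_nbhs.
  move=> [[A C] /= [[[A' B'] /= [nA nB] AB] nC] ACU].
  have [a [ax aA]] := rball_nbhs nA.
  have [b [bx bB]] := rball_nbhs nB.
  have [c [cx cC]] := rball_nbhs nC.
  exists (a, b, c) => //; case: asboolP => //; case.
  move=> [[x' y'] z'] /= [[/aA ? /bB ?] /cC ?].
  by apply: ACU; split => //=; apply: AB.
apply: countable_bigcupT_measurable => // q; case: ifPn => // _.
by apply: measurableX; [apply: measurableX|]; apply: open_measurable;
  exact: ball_open.
Qed.

End open_measurable3.

(** * Cells *)

Section cells.
Context {R : realType}.
Variables (eps : R) (eps0 : 0 < eps).
Implicit Types (xi : Z3) (x y : R3 R) (Omega : set (R3 R)).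

Definition uncell_map xi x : R3 R := eps^-1 *: (x - eps *: z3r xi).

Lemma cell_mapK xi : cancel (cell_map eps xi) (uncell_map xi).
Proof.
move=> y; rewrite /uncell_map /cell_map addrC addKr scalerA mulVf ?scale1r//.
by rewrite gt_eqF.
Qed.

Lemma uncell_mapK xi : cancel (uncell_map xi) (cell_map eps xi).
Proof.
move=> x; rewrite /uncell_map /cell_map scalerA divff ?gt_eqF// scale1r.
by rewrite addrC subrK.
Qed.

Lemma enormZ (c : R) x : 0 <= c -> enorm (c *: x) = c * enorm x.
Proof.
move=> c0; rewrite /enorm (_ : dot _ _ = c ^+ 2 * dot x x).
  by rewrite sqrtrM ?sqr_ge0// sqrtr_sqr ger0_norm.
by rewrite /dot /= /GRing.scale/=; ring.
Qed.

Lemma enorm_cell_map xi x y :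
  enorm (cell_map eps xi x - cell_map eps xi y) = eps * enorm (x - y).
Proof. by rewrite /cell_map opprD addrACA subrr add0r -scalerBr enormZ// ltW. Qed.

Definition cell xi : set (R3 R) := [set x | int_part (eps^-1 *: x) = xi].

Definition open_cell xi : set (R3 R) := cell_map eps xi @` unit_cell.

Let floorE (t : R) (n : int) :
  Num.floor (eps^-1 * t) = n <-> t \in `[eps * n%:~R, eps * (n%:~R + 1)[.
Proof.
rewrite in_itv/= -![eps * _ <= _]ler_pdivlMl// -[t < _]ltr_pdivrMl//.
by apply: (iff_trans (rwP eqP)); rewrite floor_eq intrD.
Qed.

Let side (b : bool) (n : int) : set R :=
  [set` Interval (BSide b (eps * n%:~R)) (BLeft (eps * (n%:~R + 1)))].

Let box b xi : set (R3 R) := side b xi.1.1 `*` side b xi.1.2 `*` side b xi.2.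

Let cellE xi : cell xi = box true xi.
Proof.
case: xi => [[i j] l]; apply/seteqP; split=> -[[a b] c] /=.
  by rewrite /cell /int_part/= => -[/floorE ? /floorE ? /floorE ?].
move=> [[/floorE ? /floorE ?] /floorE ?].
by rewrite /cell /int_part/=; congr (_, _, _).
Qed.

Let open_cellE xi : open_cell xi = box false xi.
Proof.
case: xi => [[i j] l].
rewrite /open_cell (image_similarity (cell_mapK _) (uncell_mapK _)).
have E (t : R) (n : int) :
    (0 < eps^-1 * (t - eps * n%:~R) < 1) =
    (t \in Interval (BSide false (eps * n%:~R)) (BLeft (eps * (n%:~R + 1)))).
  rewrite in_itv/= pmulr_rgt0 ?invr_gt0// subr_gt0 ltr_pdivrMl// mulr1.
  by rewrite ltrBlDl mulrDr mulr1.
apply/seteqP; split=> -[[a b] c] /=.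
  by rewrite /unit_cell /uncell_map/= /GRing.scale/= !E => -[].
by rewrite /unit_cell /uncell_map/= /GRing.scale/= !E => -[[]].
Qed.

Let measurable_side b n : measurable (side b n : set (measurableTypeR R)).
Proof. exact: measurable_itv. Qed.

Let measurable_box b xi : measurable (box b xi : set (borelR3 R)).
Proof. by do 2![apply: measurableX => //]. Qed.

Let lebesgue_side b n : lebesgue_measure (side b n) = eps%:E.
Proof.
rewrite lebesgue_measure_itv/= lte_fin ltr_pM2l// ltrDl ltr01 -EFinD.
by congr _%:E; ring.
Qed.

Local Open Scope ereal_scope.

Let lebesgue3_box b xi : lebesgue3 (box b xi) = (eps ^+ 3)%:E.
Proof.
pose mu := @lebesgue_measure R.
transitivity ((mu \x mu)%E (side b xi.1.1 `*` side b xi.1.2) * mu (side b xi.2)).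
  by apply: (product_measure1E (mu \x mu)%E mu) => //; exact: measurableX.
transitivity (mu (side b xi.1.1) * mu (side b xi.1.2) * mu (side b xi.2)).
  by congr (_ * _); exact: (product_measure1E mu mu).
have muE n : mu (side b n) = eps%:E := lebesgue_side b n.
by rewrite !muE -!EFinM; congr _%:E; ring.
Qed.

Lemma measurable_cell xi : measurable (cell xi : set (borelR3 R)).
Proof. by rewrite cellE. Qed.

Lemma measurable_open_cell xi : measurable (open_cell xi : set (borelR3 R)).
Proof. by rewrite open_cellE. Qed.

Lemma lebesgue3_cell xi : lebesgue3 (cell xi) = (eps ^+ 3)%:E.
Proof. by rewrite cellE. Qed.

Lemma lebesgue3_open_cell xi : lebesgue3 (open_cell xi) = (eps ^+ 3)%:E.
Proof. by rewrite open_cellE. Qed.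

Lemma open_cell_sub xi : open_cell xi `<=` cell xi.
Proof.
rewrite cellE open_cellE => -[[a b] c] /=.
rewrite /box /side /= !in_itv/=.
by move=> [[/andP[/ltW -> ->] /andP[/ltW -> ->]] /andP[/ltW -> ->]].
Qed.

(** The open and the half-open cell have the same volume, so whatever part of the
faces belongs to A does not matter. *)
Lemma lebesgue3_cell_sandwich xi (A : set (borelR3 R)) : measurable A ->
  open_cell xi `<=` A -> A `<=` cell xi -> lebesgue3 A = (eps ^+ 3)%:E.
Proof.
move=> mA oA Ac; apply/eqP; rewrite eq_le; apply/andP; split.
  rewrite -(lebesgue3_cell xi); apply: le_measure; rewrite ?inE//.
  exact: measurable_cell.
rewrite -(lebesgue3_open_cell xi); apply: le_measure; rewrite ?inE//.
exact: measurable_open_cell.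
Qed.

Lemma lebesgue3_cell_faces xi : lebesgue3 (cell xi `\` open_cell xi) = 0.
Proof.
transitivity (lebesgue3 (cell xi) - lebesgue3 (cell xi `&` open_cell xi)).
  apply: measureD; [exact: measurable_cell|exact: measurable_open_cell|].
  apply: (@le_lt_trans _ _ (eps ^+ 3)%:E); last exact: ltry.
  by rewrite -(lebesgue3_cell xi).
rewrite setIidr; last exact: open_cell_sub.
by rewrite lebesgue3_cell lebesgue3_open_cell subee.
Qed.

Let coord_continuous : continuous (fun x : R3 R => x.1.1) /\
  continuous (fun x : R3 R => x.1.2) /\ continuous (fun x : R3 R => x.2).
Proof.
split; [|split] => x; rewrite /continuous_at; last exact: cvg_snd.
  by apply: cvg_comp; exact: cvg_fst.
by apply: cvg_comp; [exact: cvg_fst|exact: cvg_snd].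
Qed.

Lemma open_unit_cell : open (@unit_cell R).
Proof.
have [c1 [c2 c3]] := coord_continuous.
have -> : @unit_cell R = ((fun x => x.1.1) @^-1` `]0%R, 1%R[) `&`
    ((fun x => x.1.2) @^-1` `]0%R, 1%R[) `&` ((fun x => x.2) @^-1` `]0%R, 1%R[).
  by apply/seteqP; split=> x /=; rewrite !in_itv/=; [move=> []|move=> [[]]].
by apply: openI; [apply: openI|]; apply: open_comp => // x _;
  first [exact: c1|exact: c2|exact: c3].
Qed.

Lemma continuous_cell_map xi : continuous (cell_map eps xi).
Proof.
move=> y; rewrite /cell_map.
apply: (@continuousD R (R3 R) (R3 R) (cst (eps *: z3r xi)) (fun z => eps *: z)).
  exact: cst_continuous.
exact: scaler_continuous.
Qed.

Lemma continuous_uncell_map xi : continuous (uncell_map xi).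
Proof.
move=> y; apply: continuous_comp; last exact: scaler_continuous.
apply: (@continuousB R (R3 R) (R3 R) id (cst (eps *: z3r xi))).
  exact: cvg_id.
exact: cst_continuous.
Qed.

Lemma open_open_cell xi : open (open_cell xi).
Proof.
rewrite /open_cell (image_similarity (cell_mapK _) (uncell_mapK _)).
apply: open_comp; last exact: open_unit_cell.
by move=> x _; exact: continuous_uncell_map.
Qed.

(** The open cell is an open subset of the union of closed cells, hence a subset of
its interior. *)
Lemma open_cell_Omega_hat Omega xi : Xi eps Omega xi ->
  open_cell xi `<=` Omega_hat eps Omega.
Proof.
move=> Xixi; apply: (@subset_trans _ (open_cell xi)^°).
  by have /interior_id -> := @open_open_cell xi.
apply: interiorS => x [y yY <-]; exists xi => //; exists y => //.
exact: subset_closure.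
Qed.

(** A point of Omega_hat is a limit of points of an open cell of index xi' in Xi. If
it is also in the open cell of index xi, which is a neighbourhood of it, then the
two open cells meet, and open cells of different indices are disjoint. *)
Lemma Xi_open_cell_Omega_hat Omega xi x :
  open_cell xi x -> Omega_hat eps Omega x -> Xi eps Omega xi.
Proof.
move=> xix /interior_subset[xi' Xixi' [y cly yx]].
have : nbhs y (cell_map eps xi' @^-1` open_cell xi).
  apply: (continuous_cell_map (xi := xi') (x := y)).
  by rewrite yx; apply: open_nbhs_nbhs; split => //; exact: open_open_cell.
move=> /cly[z [zY /open_cell_sub <-]].
by rewrite (_ : int_part _ = xi')//; apply: open_cell_sub; exists z.
Qed.

End cells.

(** * Integrals of functions with countably many values *)

Section esum_extra.
Context {R : realType}.
Local Open Scope ereal_scope.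

Lemma esumZl (I : choiceType) (P : set I) (c : R) (a : I -> \bar R) :
  (0 < c)%R -> (forall i, 0 <= a i) ->
  \esum_(i in P) (c%:E * a i) = c%:E * \esum_(i in P) a i.
Proof.
move=> c0 a0; rewrite /esum -ereal_sup_pZl// image_comp; congr ereal_sup.
by apply: eq_imagel => J _ /=; rewrite ge0_mule_fsumr.
Qed.

End esum_extra.

Section integral_countable_valued.
Context d (T : measurableType d) (R : realType) (I : countType).
Variables (mu : {measure set T -> \bar R}) (D : set T) (p : T -> I).
Variable (G : I -> \bar R).
Hypothesis mp : forall i, measurable (D `&` p @^-1` [set i]).
Hypothesis G0 : forall i, (0 <= G i)%E.
Local Open Scope ereal_scope.

(** The domain is cut into the level sets of p. Countable additivity is stated for
sequences, hence the sets E n, which enumerate the level sets along the encoding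
of I in the natural numbers and are empty at the numbers that encode nothing. *)
Lemma ge0_integral_countable_valued :
  \int[mu]_(x in D) G (p x) =
  \esum_(i in setT) (G i * mu (D `&` p @^-1` [set i])).
Proof.
pose E n := D `&` (pickle \o p) @^-1` [set n].
have E_pickle i : E (pickle i) = D `&` p @^-1` [set i].
  apply/seteqP; split=> x [Dx /= px]; split => //=; last by rewrite px.
  exact: (pcan_inj pickleK px).
have E0 n : ~ range (@pickle I) n -> E n = set0.
  move=> pn; apply/seteqP; split=> x// [Dx /= px]; apply: pn.
  by exists (p x).
have mE n : measurable (E n).
  have [[i _ <-]|/E0 ->] := pselect (range (@pickle I) n).
    by rewrite E_pickle.
  exact: measurable0.
have GE i : {in E (pickle i), (fun x => G (p x)) =1 cst (G i)}.
  by move=> x /set_mem; rewrite E_pickle => -[_ /= ->].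
have DE : D = \bigcup_n E n.
  by apply/seteqP; split=> [x Dx|x [n _ []//]]; exists (pickle (p x)).
have mG n : measurable_fun (E n) (fun x => G (p x)).
  have [[i _ <-]|/E0 ->] := pselect (range (@pickle I) n).
    by apply: eq_measurable_fun (measurable_cst (G i)) => x /GE.
  exact: measurable_fun_set0.
rewrite [in LHS]DE ge0_integral_bigcup//; last 2 first.
- exact/measurable_fun_bigcup.
- by move=> n m _ _ [x [[_ /= <-] [_ /= <-]]].
rewrite nneseries_esumT; last by move=> n; exact: integral_ge0.
transitivity (\esum_(n in range (@pickle I)) \int[mu]_(x in E n) G (p x)).
  rewrite [RHS]esum_mkcond; apply: eq_esum => n _; case: ifPn => // /negP pn.
  by rewrite E0 ?integral_set0// => pn'; apply: pn; rewrite inE.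
rewrite esum_image; last by move=> i j _ _ /(pcan_inj pickleK).
apply: eq_esum => i _; rewrite (eq_integral _ _ (GE i)) integral_cst//.
by rewrite E_pickle.
Qed.

End integral_countable_valued.

(** * The unfolded function *)

Section unfolding.
Context {R : realType}.
Variables (eps alpha : R) (Omega S : set (R3 R)) (u : R3 R -> R).
Hypotheses (eps0 : 0 < eps) (oOmega : open Omega).
Local Open Scope ereal_scope.

Let G xi := gagliardo2 alpha S (u \o cell_map eps xi).

Lemma gagliardo2_ge0 (A : set (R3 R)) (v : R3 R -> R) : 0 <= gagliardo2 alpha A v.
Proof.
apply: integral_ge0 => y _; apply: integral_ge0 => x _.
by rewrite lee_fin mulr_ge0// ?exprn_ge0// invr_ge0 powR_ge0.
Qed.

Lemma gagliardo2_cst (A : set (R3 R)) (c : R) : gagliardo2 alpha A (cst c) = 0.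
Proof.
rewrite /gagliardo2 integral0_eq// => y _; rewrite integral0_eq// => x _.
by rewrite /= subrr normr0 expr0n mul0r.
Qed.

Lemma gagliardo2_unfolding x : gagliardo2 alpha S (unfolding eps Omega u x) =
  ((fun x => G (int_part (eps^-1 *: x))) \_ (Omega_hat eps Omega)) x.
Proof.
rewrite /patch /unfolding; case: ifPn => // _.
exact: (gagliardo2_cst S 0).
Qed.

Let mOmega_hat : measurable (Omega_hat eps Omega : set (borelR3 R)).
Proof.
have oh : open (Omega_hat eps Omega) by exact: open_interior.
exact: open_measurable3.
Qed.

(** When xi is not in Xi, Omega_hat contains at most points of the faces of the
cell. *)
Lemma lebesgue3_hat_cell xi :
  lebesgue3 (Omega `&` Omega_hat eps Omega `&` cell eps xi) =
  if xi \in Xi eps Omega then (eps ^+ 3)%:E else 0.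
Proof.
have mA : measurable
    (Omega `&` Omega_hat eps Omega `&` cell eps xi : set (borelR3 R)).
  apply: measurableI; last exact: (measurable_cell eps0).
  by apply: measurableI => //; exact: open_measurable3.
case: ifPn => [/set_mem Xixi|/negP nXi].
  apply: (@lebesgue3_cell_sandwich _ _ eps0 xi _ mA) => [x xix|x [] //].
  split; last exact: (open_cell_sub eps0 xix).
  by split; [exact: (Xixi _ xix)|exact: (open_cell_Omega_hat eps0 Xixi xix)].
apply: (@le_anti _ (\bar R)); apply/andP; split; last exact: measure_ge0.
rewrite -(lebesgue3_cell_faces eps0 xi); apply: le_measure; rewrite ?inE//.
  apply: measurableD; first exact: (measurable_cell eps0).
  exact: (measurable_open_cell eps0).
move=> x [[_ hx] cx]; split=> // xix; apply: nXi; rewrite inE.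
exact: (Xi_open_cell_Omega_hat eps0 xix hx).
Qed.

Lemma integral_gagliardo2_unfolding :
  \int[lebesgue3]_(x in Omega) gagliardo2 alpha S (unfolding eps Omega u x) =
  (eps `^ (1 + 2 * alpha))%:E * seminorm_S_eps2 alpha eps Omega S u.
Proof.
under eq_integral do rewrite gagliardo2_unfolding.
rewrite -integral_mkcondr.
rewrite (@ge0_integral_countable_valued _ _ R _ lebesgue3
  (Omega `&` Omega_hat eps Omega) (fun x => int_part (eps^-1 *: x)) G);
  last 2 first.
- move=> xi; apply: measurableI; last exact: (measurable_cell eps0).
  by apply: measurableI => //; exact: open_measurable3.
- by move=> xi; exact: gagliardo2_ge0.
rewrite /seminorm_S_eps2 -esumZl ?powR_gt0//; last first.
  by move=> xi; exact: gagliardo2_ge0.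
rewrite [RHS]esum_mkcond; apply: eq_esum => xi _.
rewrite [X in _ * X]lebesgue3_hat_cell; case: ifPn => _; last by rewrite mule0.
rewrite (gagliardo2_similarity (cell_mapK eps0 xi) (uncell_mapK eps0 xi) eps0
  (enorm_cell_map eps0 xi))//.
rewrite muleA -EFinM muleC -powRD; last by rewrite (gt_eqF eps0) implybT.
congr (_%:E * _); rewrite -powR_mulrn ?(ltW eps0)//; congr (_ `^ _)%R; ring.
Qed.

End unfolding.

Theorem lemma3p4 (R : realType) (Omega Sdom S : set (R3 R)) (eps : R)
  (Omega_domain : is_domain Omega)
  (Omega_bounded : bounded_set Omega)
  (Omega_lipschitz : lipschitz_boundary Omega)
  (Sdom_domain : is_domain Sdom)
  (Sdom_strict : closure Sdom `<=` unit_cell)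
  (Sdom_C11 : C11_boundary Sdom)
  (S_closure : exists U : set (R3 R),
    [/\ open U, connected (U `&` frontier Sdom) &
        S = closure (U `&` frontier Sdom)])
  (eps_gt0 : 0 < eps) :
  forall alpha : R, 0 < alpha < 1 ->
  forall u : R3 R -> R, H_S_eps alpha eps Omega S u ->
  seminorm_L2H alpha Omega S (unfolding eps Omega u) =
  ((eps `^ (2^-1 + alpha))%:E * seminorm_S_eps alpha eps Omega S u)%E.
Proof.
move=> alpha _ u _; case: Omega_domain => oOmega _ _.
rewrite /seminorm_L2H integral_gagliardo2_unfolding// /seminorm_S_eps.
rewrite sqrteM ?lee_fin ?powR_ge0//; congr (_ * _)%E => /=.
have -> : 1 + 2 * alpha = (2^-1 + alpha) + (2^-1 + alpha) by field.
rewrite powRD ?(gt_eqF eps_gt0) ?implybT// -expr2 sqrtr_sqr ger0_norm//.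
exact: powR_ge0.
Qed.
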